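(* If $M$ is a matroid of rank $r$ on $n$ elements, then $$f_{total}(\mathscr{T}_{S^0} M) \;\leq\; f_{total}(\mathscr{T}_{S^0} U_{r,n}) \;=\; 1+ \sum_{i = 0}^{r} \binom{n}{i} \cdot (2 F_i - 0^i) \cdot (3^{r-i}-1),$$ where $F_i = \sum_{k = 0}^{i} k!\,S(i,k)$ is the $i$-th ordered Bell (Fubini) number.
   Context: $S(i,k)$ is the Stirling number of the second kind, and $0^0=1$, $0^i=0$ for $i\ge1$. $U_{r,n}$ is the uniform matroid of rank $r$ on $[n]=\{1,\dots,n\}$ (its flats are $[n]$ and all subsets of size less than $r$). $S^0$ is the CW complex consisting of two points. For a matroid $M$ of rank $r$, $L(M)$ is its lattice of flats ordered by inclusion, $\operatorname{corank}(p)=r-\operatorname{rk}(p)$, $\Delta(P)$ is the order complex of a poset $P$, and $L(M)_{\le p}=\{q\in L(M): q\le p\}$. Engström representation with $X=S^0$. For $p\in L(M)$ let $D(p)$ be the join of $\operatorname{corank}(p)$ copies of $S^0$, indexed by $\{1,\dots,\operatorname{corank}(p)\}$ (the empty join is the empty space), with the standard cell structure of a join. For $p\ge q$ let $d_{pq}:D(p)\to D(q)$ be the inclusion induced by $\{1,\dots,\operatorname{corank}(p)\}\subseteq\{1,\dots,\operatorname{corank}(q)\}$. Then $$\mathscr{T}_{S^0} M = \coprod_{p\in L(M)} \bigl(\Delta(L(M)_{\le p})\times D(p)\bigr)\big/\sim,$$ where $\sim$ is the equivalence relation generated by: for $(a,x)\in\Delta(L(M)_{\le p})\times D(p)$ and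 $(b,y)\in\Delta(L(M)_{\le q})\times D(q)$, $(a,x)\sim(b,y)$ if $p\ge q$, $d_{pq}(x)=y$ and $a=b$. It is a CW complex whose open cells are the images of the open product cells $\sigma\times e$ of the spaces $\Delta(L(M)_{\le p})\times D(p)$ (identified cells being counted once). For a finite CW complex $\Delta$, $f_{total}(\Delta)$ is the total number of faces of $\Delta$ including the empty face, i.e. $1$ plus the number of cells (so it equals $1$ for the empty complex). *)

(* Defs.v *)
From HB Require Import structures.
From Stdlib Require Import Relations.
From mathcomp Require Import all_boot all_order all_algebra.
From mathcomp Require Import finmap generic_quotient.
From mathcomp Require Import all_classical all_reals all_analysis.

Set Implicit Arguments.
Unset Strict Implicit.
Unset Printing Implicit Defensive.

Import Order.TTheory GRing.Theory Num.Theory.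
Import numFieldTopology.Exports.
Local Open Scope nat_scope.

Record matroid (E : finType) := Matroid {
  indep :> pred {set E};
  indep0 : indep finset.set0;
  indep_sub : forall I J : {set E}, J \subset I -> indep I -> indep J;
  indep_augment : forall I J : {set E}, indep I -> indep J -> #|I| < #|J| ->
    exists2 x, x \in J :\: I & indep (x |: I)%SET
}.

Section Matroids.
Variables (E : finType) (M : matroid E).

Definition rk (A : {set E}) : nat :=
  \max_(I : {set E} | indep M I && (I \subset A)) #|I|.

Definition matroid_rank : nat := rk [set: E]%SET.

Definition is_flat (F : {set E}) : bool :=
  [forall x, (x \notin F) ==> (rk F < rk (x |: F)%SET)].

Record flat := Flat { flat_set :> {set E}; flatP : is_flat flat_set }.

HB.instance Definition _ := [isSub for flat_set].
HB.instance Definition _ := [Finite of flat by <:].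

Definition flat_le (p q : flat) : bool := (p \subset q).

Fact flat_le_refl : reflexive flat_le.
Proof. by move=> p; exact: subxx. Qed.

Fact flat_le_anti : antisymmetric flat_le.
Proof. by move=> p q pq; apply/val_inj/eqP; rewrite finset.eqEsubset. Qed.

Fact flat_le_trans : transitive flat_le.
Proof. by move=> q p s; rewrite /flat_le; exact: fintype.subset_trans. Qed.

Fact flat_display : Order.disp_t. Proof. exact: Order.Disp. Qed.

HB.instance Definition _ := Order.Le_isPOrder.Build flat_display flat
  flat_le_refl flat_le_anti flat_le_trans.

Definition corank (p : flat) : nat := matroid_rank - rk p.

Lemma rkS (A B : {set E}) : A \subset B -> rk A <= rk B.
Proof.
move=> AB; apply/bigmax_leqP => I /andP[indI IA].
apply: (@leq_bigmax_cond _ _ (fun I : {set E} => #|I|)).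
by rewrite indI (fintype.subset_trans IA AB).
Qed.

Lemma corank_anti (p q : flat) : (q <= p)%O -> corank p <= corank q.
Proof. by move=> qp; rewrite leq_sub2l// rkS. Qed.

End Matroids.

Section Uniform.
(* The rank is [minn r n], that is [r] in the intended range r <= n. *)
Variables r n : nat.

Definition uniform_indep : pred {set 'I_n} := fun I => #|I| <= r.

Fact uniform_indep0 : uniform_indep finset.set0.
Proof. by rewrite /uniform_indep cards0. Qed.

Fact uniform_indep_sub (I J : {set 'I_n}) :
  J \subset I -> uniform_indep I -> uniform_indep J.
Proof. by move=> /subset_leq_card; exact: leq_trans. Qed.

Fact uniform_indep_augment (I J : {set 'I_n}) :
  uniform_indep I -> uniform_indep J -> #|I| < #|J| ->
  exists2 x, x \in J :\: I & uniform_indep (x |: I)%SET.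
Proof.
rewrite /uniform_indep => _ Jr IJ.
have /finset.set0Pn[x xJI] : (J :\: I)%SET != finset.set0.
  rewrite finset.setD_eq0; apply: contraTN IJ => /subset_leq_card.
  by rewrite -leqNgt.
exists x => //; move: xJI; rewrite finset.in_setD => /andP[xI _].
by rewrite cardsU1 xI add1n (leq_trans IJ).
Qed.

Definition uniform_matroid : matroid 'I_n :=
  Matroid uniform_indep0 uniform_indep_sub uniform_indep_augment.

End Uniform.

(* A simplicial complex with vertices in [V] is given by the set of its
   simplices, the empty one included. *)

Definition order_complex d (P : finPOrderType d) (A : {set P}) :
    {set {set P}} :=
  [set s : {set P} | (s \subset A) &&
     [forall x in s, forall y in s, (x <= y)%O || (y <= x)%O]]%SET.

(* The join of copies of [K] indexed by [I]: the vertices are tagged with the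
   copy they come from, and a simplex is a union of one (possibly empty)
   simplex of each copy. *)
Definition join_complex (I V : finType) (K : {set {set V}}) :
    {set {set I * V}} :=
  [set s : {set I * V} |
     [forall i, [set v | (i, v) \in s]%SET \in K]]%SET.

Definition S0 : {set {set bool}} := [set s : {set bool} | #|s| <= 1]%SET.

Section Realization.
Local Open Scope ring_scope.
Local Open Scope classical_set_scope.
Variable R : realType.

Definition support_of (V : finType) (x : V -> R) : {set V} :=
  [set v | x v != 0]%SET.

(* Points in barycentric coordinates, with the topology induced from R^V.
   If [V] is empty the coordinates cannot sum to 1 and the realization is
   empty; in particular so is the join of zero copies. *)
Definition realization (V : finType) (K : {set {set V}}) :
    set {ptws V -> R} :=
  [set x | [/\ forall v, 0 <= x v, \sum_v x v = 1 & support_of x \in K]].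

Definition open_simplex (V : finType) (K : {set {set V}}) (s : {set V}) :
    set (realization K) :=
  [set x | support_of (set_val x) = s].

(* The affine extension of a vertex map. *)
Definition push (V W : finType) (f : V -> W) (x : V -> R) : {ptws W -> R} :=
  fun w => \sum_(v | f v == w) x v.

Lemma support_push (V W : finType) (f : V -> W) (x : V -> R) :
  (forall v, 0 <= x v) -> support_of (push f x) = (f @: support_of x)%SET.
Proof.
move=> x0; apply/setP => w; rewrite !inE /push.
rewrite psumr_neq0//; apply/idP/imsetP.
  move=> /hasP[v _ /andP[/eqP <- xv]].
  by exists v => //; rewrite inE gt_eqF.
move=> [v]; rewrite inE => xv ->; apply/hasP; exists v => /=.
  by rewrite mem_index_enum.
by rewrite eqxx lt0r xv x0.
Qed.

Lemma push_realization (V W : finType) (K : {set {set V}})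
    (L : {set {set W}}) (f : V -> W) (x : realization K) :
  (forall s, s \in K -> (f @: s)%SET \in L) ->
  realization L (push f (set_val x)).
Proof.
move=> fKL; have /set_mem[/= x0 x1 xK] := valP x; split.
- by move=> w; apply: sumr_ge0 => v _; exact: x0.
- rewrite -[RHS]x1 [RHS](partition_big f predT)//=.
- by rewrite support_push//; exact: fKL.
Qed.

Definition realization_map (V W : finType) (K : {set {set V}})
    (L : {set {set W}}) (f : V -> W)
    (fKL : forall s, s \in K -> (f @: s)%SET \in L) (x : realization K) :
    realization L :=
  SigSub (mem_set (push_realization x fKL)).

End Realization.
Arguments realization R {V} K.

Definition widen_copy (V : finType) (m n : nat) (mn : m <= n)
    (u : 'I_m * V) : 'I_n * V :=
  (widen_ord mn u.1, u.2).

Lemma widen_copy_simplicial (m n : nat) (mn : m <= n)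
    (s : {set 'I_m * bool}) :
  s \in join_complex 'I_m S0 ->
  (widen_copy mn @: s)%SET \in join_complex 'I_n S0.
Proof.
rewrite !inE => /forallP sK; apply/forallP => j; rewrite inE.
case: (ltnP j m) => [jm|mj].
  apply: leq_trans (_ : #|[set v | (Ordinal jm, v) \in s]%SET| <= 1).
  2: by have := sK (Ordinal jm); rewrite inE.
  apply/subset_leq_card/fintype.subsetP => v.
  rewrite !inE => /imsetP[[i w] /= iws [ji ->]].
  suff -> : Ordinal jm = i by [].
  by apply: val_inj => /=; rewrite ji.
rewrite (_ : [set v | _]%SET = finset.set0) ?cards0//.
apply/setP => v; rewrite !inE; apply/negP => /imsetP[[i w] /= _ [ji _]].
by move: mj; rewrite ji /= leqNgt ltn_ord.
Qed.

(* A space with a set of open cells.  The CW axioms are not part of the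
   structure: only the number of cells matters below. *)
Record cell_complex := CellComplex {
  cell_space :> topologicalType;
  cells : set (set cell_space)
}.
Arguments cells : clear implicits.

(* [fset_set] is the empty set on an infinite argument; the complexes below
   have finitely many cells by [finite_cells]. *)
Definition f_total (X : cell_complex) : nat := 1 + #|` fset_set (cells X)|.

Section Engstrom.
Variables (R : realType) (E : finType) (M : matroid E).
Local Open Scope classical_set_scope.
Local Open Scope quotient_scope.

Definition order_complex_below (p : flat M) : {set {set flat M}} :=
  order_complex [set q : flat M | (q <= p)%O]%SET.

Definition D_complex (p : flat M) : {set {set 'I_(corank p) * bool}} :=
  join_complex 'I_(corank p) S0.

Definition engstrom_D (p : flat M) : topologicalType :=
  set_type (realization R (D_complex p)).

Definition engstrom_d (p q : flat M) (qp : (q <= p)%O) :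
    engstrom_D p -> engstrom_D q :=
  realization_map (@widen_copy_simplicial _ _ (corank_anti qp)).

Definition summand (p : flat M) : topologicalType :=
  (set_type (realization R (order_complex_below p)) * engstrom_D p)%type.

Definition coprod : topologicalType := {p : flat M & summand p}.

(* All the order complexes have their vertices in [flat M], so a = b is an
   equality of barycentric coordinates indexed by [flat M]. *)
Definition glue (u v : coprod) : Prop :=
  exists qp : (projT1 v <= projT1 u)%O,
    engstrom_d qp (projT2 u).2 = (projT2 v).2 /\
    set_val (projT2 u).1 = set_val (projT2 v).1.

Definition glue_equiv (u v : coprod) : bool :=
  `[< clos_refl_sym_trans coprod glue u v >].

Fact glue_equiv_refl : reflexive glue_equiv.
Proof. by move=> u; apply/asboolP; exact: rst_refl. Qed.

Fact glue_equiv_sym : symmetric glue_equiv.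
Proof. by move=> u v; apply/asboolP/asboolP => uv; exact: rst_sym. Qed.

Fact glue_equiv_trans : transitive glue_equiv.
Proof.
by move=> v u w /asboolP uv /asboolP vw; apply/asboolP; exact: rst_trans uv vw.
Qed.

Canonical glue_equiv_rel :=
  EquivRel glue_equiv glue_equiv_refl glue_equiv_sym glue_equiv_trans.

Definition engstrom_space : topologicalType :=
  quotient_topology {eq_quot glue_equiv_rel}.

Definition engstrom_proj (u : coprod) : engstrom_space :=
  \pi_{eq_quot glue_equiv_rel} u.

Definition product_cell (p : flat M) (s : {set flat M})
    (e : {set 'I_(corank p) * bool}) : set coprod :=
  existT summand p @`
    (open_simplex (K := order_complex_below p) s `*`
     open_simplex (K := D_complex p) e).

Definition engstrom_cells : set (set engstrom_space) :=
  [set C | exists (p : flat M) (s : {set flat M})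
             (e : {set 'I_(corank p) * bool}),
     [/\ s \in order_complex_below p, s != finset.set0,
         e \in D_complex p, e != finset.set0 &
         C = engstrom_proj @` product_cell s e]].

Lemma finite_cells : finite_set engstrom_cells.
Proof.
pose T := {p : flat M & ({set flat M} * {set 'I_(corank p) * bool})%type}.
pose f (t : T) := engstrom_proj @` product_cell (projT2 t).1 (projT2 t).2.
apply: (@sub_finite_set _ _ (range f)); last exact/finite_image/finite_finset.
by move=> _ [p [s [e [_ _ _ _ ->]]]]; exists (existT _ p (s, e)).
Qed.

Definition engstrom_S0 : cell_complex := CellComplex engstrom_cells.

End Engstrom.

Definition stirling2 (i k : nat) : nat :=
  #|[set P : {set {set 'I_i}} |
      finset.partition P [set: 'I_i] && (#|P| == k)]%SET|.

Definition fubini (i : nat) : nat := \sum_(0 <= k < i.+1) k`! * stirling2 i k.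

(* Main.v *)
Require Import Defs.
From mathcomp Require Import all_boot all_order all_algebra.
From Stdlib Require Import Relation_Operators.
From mathcomp Require Import finmap generic_quotient.
From mathcomp Require Import all_classical all_reals all_analysis.

Set Implicit Arguments.
Unset Strict Implicit.
Unset Printing Implicit Defensive.

(* Finite sets take precedence over classical sets: [set0], [setP], etc. *)
Import mathcomp.boot.fintype mathcomp.boot.finset.
Import Order.TTheory GRing.Theory Num.Theory.

Local Open Scope nat_scope.

(** Both claims reduce to counting chains of flats.

    A point [(a, x)] of the summand of [p] is glued to a point of the summand
    of every smaller flat that still bounds the support of [a], the least of
    which is the maximum of that support.  Hence every cell comes from exactly
    one product [s * e] sitting in the summand of [p = max s], where [s] is a
    nonempty chain of flats and [e] a nonempty simplex of the join of
    [corank p] copies of [S^0], of which there are [3 ^ corank p - 1].  So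
    [f_total] is [1] plus the sum over the flats [p] of
    [c p * (3 ^ corank p - 1)], where [c p] is the number of chains with
    maximum [p] ([f_total_engstrom]).

    Removing the maximum of a chain gives [c p = 1 + \sum_(q < p) c q]
    ([card_chains_with_max]).  The numbers [h i = 2 F_i - 0 ^ i] satisfy the
    same recursion over the proper subsets of an [i]-element set
    ([boolean_chains_card]), because an ordered set partition is determined by
    its last block and the ordered partition of the remaining elements.  In the
    uniform matroid every set with fewer than [r] elements is a flat, whence
    [c p = h #|p|] there, and the flats of corank 0 contribute nothing; this
    is the formula.

    For an arbitrary matroid, [c p] is at most the sum of [h #|B|] over the
    bases [B] of [p] ([card_chains_flat_le]), by induction on [p]: a basis of
    some [q < p] extends to a basis of [p], properly since a basis determines
    the flat that it spans.  Summing over [p] counts every independent set at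
    most once, so the total for rank [i] is at most [binom(n, i) * h i], as
    for the uniform matroid. *)

(** * Ordered set partitions and chains of sets *)

Lemma sum_proper_card (T : finType) (A : {set T}) (g : nat -> nat) :
  \sum_(B : {set T} | B \proper A) g #|B| =
  \sum_(j < #|A|) 'C(#|A|, j) * g j.
Proof.
have [A0|A0] := eqVneq A set0.
  rewrite A0 cards0 big_ord0 big_pred0// => B.
  by rewrite properE sub0set andbF.
have Agt0 : 0 < #|A| by rewrite card_gt0.
case E : #|A| Agt0 => [//|m] _.
rewrite (partition_big (fun B : {set T} => inord #|B| : 'I_m.+1) predT)//=.
apply: eq_bigr => j _.
transitivity (\sum_(B : {set T} | (B \subset A) && (#|B| == j)) g j).
  apply: eq_big => [B|B /andP[BA /eqP <-]]; last first.
    by rewrite inordK// -E proper_card.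
  rewrite properEcard E; case: (boolP (B \subset A)) => //= BA.
  case: (ltnP #|B| m.+1) => mB /=; first by rewrite -val_eqE /= inordK.
  apply/esym/negbTE; apply: contraTneq mB => ->.
  by rewrite -ltnNge ltn_ord.
rewrite -[X in 'C(X, _)]E -cards_draws sum_nat_const; congr (_ * _).
by apply: eq_card => B; rewrite inE.
Qed.

(** A partition into [k] blocks has [k!] orderings.  Allowing any finite set,
    and not only an ordinal, makes the recursion over subsets possible. *)
Definition ordered_partitions (T : finType) (A : {set T}) : nat :=
  \sum_(P : {set {set T}} | partition P A) (#|P|)`!.

Lemma fubiniE i : fubini i = ordered_partitions [set: 'I_i]%SET.
Proof.
rewrite /fubini big_mkord /ordered_partitions.
rewrite (partition_big (fun P : {set {set 'I_i}} => inord #|P| : 'I_i.+1)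
  predT)//=; apply: eq_bigr => k _.
rewrite mulnC /stirling2 -sum_nat_const.
apply: eq_big => [P|P /[!inE] /andP[_ /eqP ->]//].
rewrite inE; case: (boolP (partition P _)) => //= Pp.
rewrite -val_eqE /= inordK// ltnS -[leqRHS]card_ord -cardsT.
rewrite (card_partition Pp) -sum1_card leq_sum// => B BP.
by rewrite card_gt0; exact: partition_neq0 Pp BP.
Qed.

(** The set [B] on the right is what remains of [A] when the last block of an
    ordered partition is removed. *)
Lemma ordered_partitions_rec (T : finType) (A : {set T}) :
  ordered_partitions A =
  (A == set0) + \sum_(B : {set T} | B \proper A) ordered_partitions B.
Proof.
have [->|A0] := eqVneq A set0.
  rewrite /ordered_partitions [X in _ = _ + X]big_pred0 => [|B]; last first.
    by rewrite properE sub0set andbF.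
  rewrite (eq_bigl (pred1 set0)) => [|P]; last first.
    by rewrite partition_set0.
  by rewrite big_pred1_eq cards0.
rewrite add0n /ordered_partitions.
transitivity (\sum_(P : {set {set T}} | partition P A)
    \sum_(B in P) (#|(P :\ B)%SET|)`!).
  apply: eq_bigr => P Pp.
  (* Choosing a last block absorbs one factor of the factorial. *)
  have P0 : 0 < #|P|.
    rewrite card_gt0; apply: contra_neq A0 => P0.
    by rewrite -(cover_partition Pp) P0 /cover big_set0.
  rewrite -[in LHS](prednK P0) factS prednK// -sum_nat_const.
  by apply: eq_bigr => B BP; rewrite (cardsD1 B) BP.
rewrite (exchange_big_dep
  (fun B : {set T} => (B != set0) && (B \subset A)))/=; last first.
  by move=> P B Pp BP; rewrite (partition_neq0 Pp BP) (partitionS Pp BP).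
(* The last block is encoded by its complement [C] in [A]. *)
rewrite (reindex_onto (fun C : {set T} => A :\: C)%SET
  (fun B : {set T} => A :\: B)%SET)/=; last first.
  by move=> B /andP[_ BA]; rewrite setDDr setDv set0U; exact/setIidPr.
apply: eq_big => [C|C /andP[/andP[AC _] /eqP CA]].
  rewrite setDDr setDv set0U subDset subsetUr.
  rewrite andbT setD_eq0 properE andbC; congr (_ && _).
  by apply/eqP/setIidPr.
have {}CA : C \subset A by rewrite -CA subDset subsetUr.
have dC : [disjoint A :\: C & C]%SET.
  by rewrite -setI_eq0 setDE -setIA (setIC _ C) setICr setI0.
have CAU : ((A :\: C) :|: C)%SET = A.
  by rewrite setUC -{1}(setIidPr CA) setID.
have CAD : (A :\: (A :\: C))%SET = C.
  by rewrite setDDr setDv set0U; exact/setIidPr.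
rewrite (reindex_onto (fun Q : {set {set T}} => (A :\: C) |: Q)%SET
  (fun P : {set {set T}} => P :\ (A :\: C))%SET)/=; last first.
  by move=> P /andP[_ CP]; rewrite setD1K.
have ACQ Q : partition Q C -> (A :\: C)%SET \notin Q.
  move=> Qp; apply: contra AC => ACQ.
  have /setIidPl <- := partitionS Qp ACQ.
  by rewrite setI_eq0.
apply: eq_big => [Q|Q]; last by move=> /andP[_ /eqP ->].
rewrite setU11 andbT; apply/andP/idP => [[Pp /eqP <-]|Qp].
  by rewrite -[X in partition _ X]CAD; apply: partitionD1 => //; rewrite setU11.
rewrite setU1K ?ACQ// eqxx; split=> //.
by rewrite -[X in partition _ X]CAU; exact: partitionU1.
Qed.

(** The recursion above involves [A] only through its cardinality. *)
Lemma ordered_partitions_fubini (T : finType) (A : {set T}) :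
  ordered_partitions A = fubini #|A|.
Proof.
have [m] := ubnP #|A|; elim: m => // m IH in T A *; rewrite ltnS => Am.
have rec (U : finType) (B : {set U}) : #|B| <= m -> ordered_partitions B =
    (#|B| == 0) + \sum_(j < #|B|) 'C(#|B|, j) * fubini j.
  move=> Bm; rewrite ordered_partitions_rec cards_eq0 -sum_proper_card.
  congr (_ + _); apply: eq_bigr => C /proper_card CB.
  by apply: IH; exact: leq_trans CB Bm.
by rewrite fubiniE !rec ?cardsT ?card_ord.
Qed.

Lemma fubini_card (T : finType) (A : {set T}) :
  fubini #|A| = (#|A| == 0) + \sum_(B : {set T} | B \proper A) fubini #|B|.
Proof.
rewrite -ordered_partitions_fubini ordered_partitions_rec cards_eq0.
by congr (_ + _); apply: eq_bigr => B _; exact: ordered_partitions_fubini.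
Qed.

(** The number of chains of subsets of an [i]-element set whose maximum is the
    whole set.  A chain that contains the empty set is an ordered partition
    (record the successive differences), and for [i > 0] the empty set may or
    may not be there; for [i = 0] the two cases coincide. *)
Definition boolean_chains (i : nat) : nat := 2 * fubini i - 0 ^ i.

Lemma boolean_chains_card (T : finType) (A : {set T}) :
  boolean_chains #|A| =
  1 + \sum_(B : {set T} | B \proper A) boolean_chains #|B|.
Proof.
have F0 : fubini 0 = 1.
  rewrite -(@cards0 T) fubini_card cards0 eqxx big_pred0// => B.
  by rewrite properE sub0set andbF.
have exp0 i : 0 ^ i = (i == 0) by case: i => // i; rewrite exp0n.
have twoF (B : {set T}) : 2 * fubini #|B| = boolean_chains #|B| + (B == set0).
  rewrite /boolean_chains exp0 cards_eq0 subnK//.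
  by have [->|_] := eqVneq; rewrite ?cards0 ?F0.
have [->|A0] := eqVneq A set0.
  rewrite big_pred0 => [|B]; last by rewrite properE sub0set andbF.
  by rewrite cards0 /boolean_chains F0.
apply: (@addIn (A == set0)); rewrite -twoF (negbTE A0) addn0.
rewrite fubini_card cards_eq0 (negbTE A0) add0n big_distrr/=.
rewrite (eq_bigr _ (fun B _ => twoF B)) big_split/= addnC; congr (_ + _).
rewrite -big_mkcondr/= sum1dep_card -(cards1 (set0 : {set T})).
apply: eq_card => B; rewrite !inE andbC.
by have [->|//] := eqVneq; rewrite /= proper0.
Qed.

(** * Chains with a given maximum *)

Definition chains_with_max d (P : finPOrderType d) (p : P) : {set {set P}} :=
  [set s in order_complex [set q | (q <= p)%O] | p \in s]%SET.

Lemma chains_with_maxP d (P : finPOrderType d) (p : P) (s : {set P}) :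
  reflect [/\ p \in s, {in s, forall q, (q <= p)%O} &
            {in s &, forall x y, (x <= y)%O || (y <= x)%O}]
    (s \in chains_with_max p).
Proof.
rewrite !inE -andbA; apply: (iffP and3P) => [[sp ch ps]|[ps sp ch]].
  split=> // [q /(subsetP sp)|x y xs ys]; first by rewrite inE.
  by move/forall_inP: ch => /(_ x xs)/forall_inP; apply.
split=> //; first by apply/subsetP => q /sp; rewrite inE.
by apply/forall_inP => x xs; apply/forall_inP => y; exact: ch.
Qed.

Lemma chain_has_max d (P : finPOrderType d) (s : {set P}) :
  s != set0 -> {in s &, forall x y, (x <= y)%O || (y <= x)%O} ->
  exists p, s \in chains_with_max p.
Proof.
move=> /set0Pn[x0 x0s] ch.
(* The maximum is the element with the largest down-set within [s]. *)
case: (@arg_maxnP _ x0 (mem s) (fun x => #|[set y in s | (y <= x)%O]%SET|) x0s).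
move=> p /= ps pmax; exists p; apply/chains_with_maxP; split=> // q qs.
have /orP[//|pq] := ch _ _ qs ps.
apply: contraLR (pmax q qs) => qp; rewrite -ltnNge proper_card//.
apply/properP; split.
  apply/subsetP => y; rewrite !inE => /andP[-> yp]/=.
  exact: le_trans yp pq.
by exists q; rewrite !inE ?qs ?lexx//= (negbTE qp).
Qed.

Lemma chains_with_max_uniq d (P : finPOrderType d) (p q : P) (s : {set P}) :
  s \in chains_with_max p -> s \in chains_with_max q -> p = q.
Proof.
move=> /chains_with_maxP[ps sp _] /chains_with_maxP[qs sq _].
by apply: le_anti; rewrite sp// sq.
Qed.

(** The chain [[set p]] accounts for 1; any other chain with maximum [p] is [p]
    added to a chain with a maximum [q < p]. *)
Lemma card_chains_with_max d (P : finPOrderType d) (p : P) :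
  #|chains_with_max p| = 1 + \sum_(q | (q < p)%O) #|chains_with_max q|.
Proof.
have pin : [set p]%SET \in chains_with_max p.
  apply/chains_with_maxP; split; first by rewrite inE.
    by move=> q /[!inE] /eqP ->.
  by move=> x y /[!inE] /eqP -> /eqP ->; rewrite lexx.
rewrite (cardsD1 [set p]%SET) pin; congr (_ + _).
rewrite -sum1_card.
transitivity (\sum_(s in (chains_with_max p :\ [set p])%SET)
   \sum_(q | (q < p)%O && ((s :\ p)%SET \in chains_with_max q)) 1).
  apply: eq_bigr => s; rewrite 2!inE => /andP[sNp /[dup] sm].
  move=> /chains_with_maxP[ps sp ch].
  have [||q qm] := @chain_has_max _ _ (s :\ p)%SET.
  - apply: contra_neq sNp => s0.
    by rewrite -(setD1K ps) s0 setU0.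
  - by move=> x y /setD1P[_ xs] /setD1P[_ ys]; exact: ch.
  rewrite (big_pred1 q)// => q'; apply/andP/eqP => [[_ q'm]|->].
    exact: chains_with_max_uniq q'm qm.
  split=> //; have /chains_with_maxP[/setD1P[qp qs] _ _] := qm.
  by rewrite lt_neqAle qp sp.
rewrite (exchange_big_dep (fun q => (q < p)%O))/=; last by move=> ? ? _ /andP[].
apply: eq_bigr => q qp.
rewrite -(@card_in_imset _ _ (fun s => p |: s)%SET) -?sum1_card.
  apply: eq_bigl => s; rewrite qp in_setD1 /=; apply/andP/imsetP.
    move=> [/andP[sp sm] tm]; exists (s :\ p)%SET => //.
    by rewrite setD1K//; case/chains_with_maxP: sm.
  move=> [t tm ->]; have /chains_with_maxP[qt tq ch] := tm.
  have tp x : x \in t -> (x < p)%O by move=> /tq xq; exact: le_lt_trans xq qp.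
  have pt : p \notin t by apply/negP => /tp; rewrite ltxx.
  rewrite setU1K//; split=> //; apply/andP; split.
    apply/eqP => /setP/(_ q); rewrite !inE qt orbT => /esym/eqP qp'.
    by rewrite qp' ltxx in qp.
  apply/chains_with_maxP; split; first by rewrite setU11.
    by move=> x /setU1P[->//|/tp/ltW].
  move=> x y /setU1P[->|xt] /setU1P[->|yt]; rewrite ?lexx//.
  - by rewrite (ltW (tp _ yt)) orbT.
  - by rewrite (ltW (tp _ xt)).
  - exact: ch.
have pN t : t \in chains_with_max q -> p \notin t.
  move=> /chains_with_maxP[_ tq _]; apply/negP => /tq.
  by move=> /(lt_le_trans qp); rewrite ltxx.
by move=> s t /pN ps /pN pt st; rewrite -(setU1K ps) st setU1K.
Qed.

(** * Bases of flats *)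

Section Bases.
Variables (E : finType) (M : matroid E).
Implicit Types (A B I : {set E}) (p q : flat M).

Definition is_basis A : pred {set E} :=
  fun B => [&& indep M B, B \subset A & #|B| == rk M A].

Lemma card_indep_le_rk A I : indep M I -> I \subset A -> #|I| <= rk M A.
Proof.
move=> iI IA; apply: (@leq_bigmax_cond _ _ (fun I : {set E} => #|I|)).
by rewrite iI.
Qed.

Lemma basis_exists A : exists B, is_basis A B.
Proof.
have P0 : indep M set0 && (set0 \subset A) by rewrite indep0 sub0set.
have [|B /andP[iB BA] eB] := @eq_bigmax_cond _
  [pred I : {set E} | indep M I && (I \subset A)] (fun I : {set E} => #|I|).
  by apply/card_gt0P; exists set0.
by exists B; rewrite /is_basis iB BA eq_sym; apply/eqP.
Qed.

Lemma basis_extension A I : indep M I -> I \subset A ->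
  exists2 B, is_basis A B & I \subset B.
Proof.
have [B0 /and3P[iB0 B0A /eqP cB0]] := basis_exists A.
have [m] := ubnP (rk M A - #|I|); elim: m => // m IH in I * => mI iI IA.
have := card_indep_le_rk iI IA; rewrite leq_eqVlt => /orP[/eqP eI|ltI].
  by exists I; rewrite // /is_basis iI IA eI /=.
have [|x /setDP[xB0 xI] ixI] := indep_augment iI iB0; first by rewrite cB0.
have [||| B bB xIB] := IH (x |: I)%SET => //.
- rewrite cardsU1 xI add1n subnS; move: ltI; rewrite -subn_gt0.
  by move: mI; case: (_ - _).
- by rewrite subUset sub1set (subsetP B0A).
- by exists B => //; apply: subset_trans xIB; exact: subsetUr.
Qed.

(** A flat is the closure of any of its bases. *)
Lemma mem_flat_basis p B x : is_basis p B ->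
  (x \in (p : {set E})) = (x \in B) || ~~ indep M (x |: B)%SET.
Proof.
move=> /and3P[iB Bp /eqP cB]; apply/idP/orP => [xp|[/(subsetP Bp)//|]].
  case: (boolP (x \in B)) => xB; [by left|right].
  apply/negP => ixB.
  have := @card_indep_le_rk p _ ixB; rewrite subUset sub1set xp Bp.
  by move=> /(_ isT); rewrite -cB cardsU1 xB ltnn.
apply: contraNT => xp; have := flatP p.
move=> /forallP/(_ x); rewrite xp /= => rkx.
have [|B' /and3P[iB' B'p /eqP cB'] BB'] := @basis_extension (x |: p)%SET _ iB.
  by apply: subset_trans Bp _; exact: subsetUr.
apply: (indep_sub _ iB'); rewrite subUset sub1set BB' andbT.
apply: contraLR rkx => xB'; rewrite -leqNgt -cB' card_indep_le_rk//.
apply/subsetP => y yB'; have /setU1P[yx|//] := subsetP B'p y yB'.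
by rewrite -yx yB' in xB'.
Qed.

Lemma flat_of_basis_uniq p q B : is_basis p B -> is_basis q B -> p = q.
Proof.
move=> bp bq; apply/val_inj/setP => x /=.
by rewrite (mem_flat_basis x bp) (mem_flat_basis x bq).
Qed.

(** Compare the recursion for chains below [p] with that for the chains of
    subsets of the bases of [p].  The summand 1 is covered because [p] has at
    least one basis; for the rest, a set [B'] occurs on the left at most once,
    as a basis of the flat [q < p] that it spans, and then it occurs on the
    right at least once, as a proper subset of some basis of [p]. *)
Lemma card_chains_flat_le p :
  #|chains_with_max p| <= \sum_(B | is_basis p B) boolean_chains #|B|.
Proof.
have [m] := ubnP #|p : {set E}|; elim: m => // m IH in p *.
rewrite ltnS => pm; rewrite card_chains_with_max.
under [leqRHS]eq_bigr do rewrite boolean_chains_card.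
rewrite big_split /= leq_add//.
  have [B bB] := basis_exists p.
  by rewrite (bigD1 B).
apply: (@leq_trans (\sum_(q | (q < p)%O)
    \sum_(B | is_basis q B) boolean_chains #|B|)).
  apply: leq_sum => q; rewrite lt_neqAle => /andP[qNp qp]; apply: IH.
  apply: leq_trans pm; apply: proper_card; rewrite properEneq.
  by rewrite (_ : (_ \subset _) = (q <= p)%O)// qp andbT.
rewrite (exchange_big_dep predT)//= [leqRHS](exchange_big_dep predT)//=.
apply: leq_sum => B' _; rewrite !sum_nat_const leq_mul2r; apply/orP; right.
have [/card0_eq c0|/card_gt0P[q]] :=
  posnP #|[pred q | (q < p)%O & is_basis q B']|.
  by rewrite (eq_card c0) card0.
rewrite inE => /andP[qp bq].
apply: (@leq_trans #|pred1 q|).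
  apply/subset_leq_card/subsetP => q'; rewrite !inE => /andP[_ bq'].
  exact/eqP/flat_of_basis_uniq/bq.
rewrite card1; apply/card_gt0P.
have /and3P[iB' B'q _] := bq.
have [|B bB B'B] := @basis_extension p _ iB'.
  by apply: subset_trans B'q _; exact: ltW qp.
exists B; rewrite -topredE /= bB properEneq B'B andbT.
apply/eqP => B'E; rewrite B'E in bq.
by move: qp; rewrite (flat_of_basis_uniq bB bq) ltxx.
Qed.

(** Every set is a basis of at most one flat, and bases of flats have at most
    [matroid_rank M] elements. *)
Lemma sum_chains_flat_le (g : nat -> nat) :
  \sum_(p : flat M) #|chains_with_max p| * g (rk M p) <=
  \sum_(B : {set E} | #|B| <= matroid_rank M) boolean_chains #|B| * g #|B|.
Proof.
apply: (@leq_trans (\sum_(p : flat M) \sum_(B | is_basis p B)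
    boolean_chains #|B| * g #|B|)).
  apply: leq_sum => p _.
  rewrite [leqRHS](eq_bigr (fun B => boolean_chains #|B| * g (rk M p))).
    by rewrite -big_distrl leq_mul2r card_chains_flat_le orbT.
  by move=> B /and3P[_ _ /eqP ->].
rewrite (exchange_big_dep (fun B => #|B| <= matroid_rank M))/=; last first.
  by move=> p B _ /and3P[_ _ /eqP ->]; rewrite rkS ?subsetT.
apply: leq_sum => B _; rewrite sum_nat_const -[leqRHS]mul1n leq_mul2r.
apply/orP; right; set k := #|_|; have [->//|/card_gt0P[p]] := posnP k.
rewrite -topredE /= => bp; rewrite -(card1 p).
apply/subset_leq_card/subsetP => q; rewrite !inE => bq.
exact/eqP/flat_of_basis_uniq/bp.
Qed.

End Bases.

Lemma sum_small_sets (T : finType) (r : nat) (g : nat -> nat) :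
  \sum_(B : {set T} | #|B| <= r) g #|B| =
  \sum_(0 <= i < r.+1) 'C(#|T|, i) * g i.
Proof.
rewrite big_mkord.
rewrite (partition_big (fun B : {set T} => inord #|B| : 'I_r.+1) predT)//=.
apply: eq_bigr => j _; rewrite -card_draws -sum_nat_const.
apply: eq_big => [B|B /andP[Br /eqP <-]]; last by rewrite inordK.
rewrite inE -val_eqE /=; case: (leqP #|B| r) => Br /=; first by rewrite inordK.
by apply/esym/negbTE; apply: contraTneq Br => ->; rewrite -leqNgt -ltnS ltn_ord.
Qed.

(** * Uniform matroids *)

Section UniformMatroid.
Variables r n : nat.
Let U := uniform_matroid r n.

Lemma rk_uniform (A : {set 'I_n}) : rk U A = minn r #|A|.
Proof.
apply/eqP; rewrite eqn_leq; apply/andP; split.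
  apply/bigmax_leqP => I /andP[Ir IA].
  by rewrite leq_min; apply/andP; split; [exact: Ir|exact: subset_leq_card].
have /card_gt0P[B] :
    0 < #|[set B : {set 'I_n} | B \subset A & #|B| == minn r #|A|]|.
  by rewrite cards_draws bin_gt0 geq_minr.
rewrite inE => /andP[BA /eqP cB]; rewrite -cB.
apply: card_indep_le_rk => //.
by rewrite /= /uniform_indep cB geq_minl.
Qed.

Lemma matroid_rank_uniform : r <= n -> matroid_rank U = r.
Proof. by rewrite /matroid_rank rk_uniform cardsT card_ord => /minn_idPl. Qed.

Lemma is_flat_uniform (A : {set 'I_n}) : #|A| < r -> is_flat U A.
Proof.
move=> Ar; apply/forallP => x; apply/implyP => xA.
by rewrite !rk_uniform cardsU1 xA add1n !(minn_idPr _) // ltnW.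
Qed.

Lemma sum_uniform_flat (P : pred {set 'I_n}) (g : {set 'I_n} -> nat) :
  (forall A, P A -> #|A| < r) ->
  \sum_(p : flat U | P p) g p = \sum_(A : {set 'I_n} | P A) g A.
Proof.
move=> Pr; rewrite [RHS](reindex_omap (val : flat U -> _) insub)/=.
  by apply: eq_bigl => p; rewrite valK eqxx andbT.
by move=> A /Pr/is_flat_uniform fA; rewrite insubT.
Qed.

Lemma card_chains_uniform (p : flat U) : #|p : {set 'I_n}| < r ->
  #|chains_with_max p| = boolean_chains #|p : {set 'I_n}|.
Proof.
have [m] := ubnP #|p : {set 'I_n}|; elim: m => // m IH in p *.
rewrite ltnS => pm pr; rewrite card_chains_with_max boolean_chains_card.
congr (_ + _); rewrite -(@sum_uniform_flat (fun A => A \proper p)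
  (fun A => boolean_chains #|A|)); last first.
  by move=> A /proper_card /ltn_trans; apply.
apply: eq_big => [q|q qp].
  by rewrite lt_neqAle properEneq.
have qp' : #|q : {set 'I_n}| < #|p : {set 'I_n}|.
  by apply: proper_card; move: qp; rewrite lt_neqAle properEneq.
by apply: IH; [exact: leq_trans qp' pm|exact: ltn_trans pr].
Qed.

(** The weight [g] has to vanish at [r]: an [r]-element set need not be a flat,
    whereas a flat of rank [r] can only be the ground set. *)
Lemma sum_chains_uniform (g : nat -> nat) : g r = 0 ->
  \sum_(p : flat U) #|chains_with_max p| * g (rk U p) =
  \sum_(A : {set 'I_n} | #|A| <= r) boolean_chains #|A| * g #|A|.
Proof.
move=> gr.
rewrite (bigID (fun p : flat U => #|p : {set 'I_n}| < r))/= [X in _ + X]big1.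
  rewrite addn0.
  rewrite [RHS](bigID (fun A : {set 'I_n} => #|A| < r))/= [X in _ = _ + X]big1.
    rewrite addn0 [RHS](eq_bigl (fun A : {set 'I_n} => #|A| < r)).
      rewrite -(@sum_uniform_flat (fun A => #|A| < r)
        (fun A => boolean_chains #|A| * g #|A|))//.
      apply: eq_bigr => p pr; rewrite card_chains_uniform// rk_uniform.
      by rewrite (minn_idPr _)// ltnW.
    by move=> A; rewrite andb_idl// => /ltnW.
  move=> A /andP[A1]; rewrite -leqNgt => A2.
  by rewrite (@anti_leq #|A| r) ?A1// gr muln0.
by move=> p; rewrite -leqNgt => /minn_idPl pr; rewrite rk_uniform pr gr muln0.
Qed.

End UniformMatroid.

(** * Cells of the Engstrom representation *)

(** In each copy of [S^0] a simplex selects no vertex or one of the two. *)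
Lemma card_join_S0 (I : finType) :
  #|(join_complex I S0 :\ set0)%SET| = 3 ^ #|I| - 1.
Proof.
have cS0 : #|S0| = 3.
  have -> : S0 = (set0 |: [set [set true]; [set false]])%SET.
    apply/setP => s; rewrite !inE leq_eqVlt ltnS leqn0 cards_eq0 orbC.
    congr (_ || _); apply/cards1P/orP => [[[] ->]|[/eqP ->|/eqP ->]].
    - by left.
    - by right.
    - by exists true.
    - by exists false.
  have t0 (b : bool) : (set0 == [set b]%SET) = false.
    by rewrite eq_sym -cards_eq0 cards1.
  have tf : ([set true] == [set false])%SET = false.
    by apply/negbTE/eqP => /setP/(_ true); rewrite !inE.
  by rewrite !cardsU1 cards1 !inE !t0 tf.
have <- : #|join_complex I S0| = 3 ^ #|I|.
  rewrite -cS0 -card_ffun_on.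
  pose copies (s : {set I * bool}) := [ffun i => [set b | (i, b) \in s]%SET].
  have copies_inj : injective copies.
    move=> s t st; apply/setP => -[i b].
    by have /ffunP/(_ i) := st; rewrite !ffunE => /setP/(_ b); rewrite !inE.
  rewrite -(card_imset _ copies_inj); apply: eq_card => f.
  apply/imsetP/ffun_onP => [[s + ->] i|fS].
    by rewrite !inE => /forallP/(_ i); rewrite ffunE inE.
  exists [set z | z.2 \in f z.1]%SET; last first.
    by apply/ffunP => i; rewrite ffunE; apply/setP => b; rewrite !inE.
  rewrite inE; apply/forallP => i.
  suff -> : [set v | (i, v) \in [set z | z.2 \in f z.1]]%SET = f i by [].
  by apply/setP => b; rewrite !inE.
rewrite [in RHS](cardsD1 set0).
suff -> : set0 \in join_complex I S0 by rewrite addKn.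
rewrite inE; apply/forallP => i; rewrite inE.
rewrite (_ : [set v | _]%SET = set0) ?cards0//.
by apply/setP => b; rewrite !inE.
Qed.

Section Cells.
Variables (R : realType) (E : finType) (M : matroid E).
Local Open Scope classical_set_scope.

Lemma widen_copy_inj (V : finType) (m n : nat) (mn : m <= n) :
  injective (@widen_copy V m n mn).
Proof.
by move=> [i v] [j w] [/= ij ->]; congr (_, _); apply: val_inj.
Qed.

Lemma open_simplex_neq0 (V : finType) (K : {set {set V}}) (s : {set V}) :
  s \in K -> s != set0 -> exists x, @open_simplex R V K s x.
Proof.
(* The barycenter. *)
move=> sK s0; pose x v : R := (if v \in s then (#|s|%:R)^-1 else 0)%R.
have s_gt0 : (0 < #|s|%:R :> R)%R by rewrite ltr0n card_gt0.
have supp_x : support_of x = s.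
  apply/setP => v; rewrite inE /x; case: ifP => _; last by rewrite eqxx.
  by rewrite invr_eq0 gt_eqF.
have xK : realization R K x.
  split; last by rewrite supp_x.
    by move=> v; rewrite /x; case: ifP => // _; rewrite invr_ge0 ltW.
  rewrite -big_mkcond/= sumr_const -(mulr_natr (_^-1)).
  by rewrite mulVf// gt_eqF.
by exists (SigSub (mem_set xK)).
Qed.

Lemma engstrom_proj_eqP (u v : coprod R M) :
  engstrom_proj u = engstrom_proj v <->
  clos_refl_sym_trans _ (@Defs.glue R E M) u v.
Proof.
split.
  by move=> /(@eqmodP _ _ u v)/asboolP.
by move=> uv; apply/(@eqmodP _ _ u v)/asboolP.
Qed.

(** The supports of the two coordinates, the second one in the join of the
    largest possible number of copies, where all the joins embed.  Gluing does
    not change this pair, so it tells cells apart. *)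
Definition cell_type (u : coprod R M) :
    {set flat M} * {set 'I_(matroid_rank M) * bool} :=
  (support_of (set_val (projT2 u).1),
   widen_copy (leq_subr _ _) @: support_of (set_val (projT2 u).2))%SET.

Lemma cell_type_proj (u v : coprod R M) :
  engstrom_proj u = engstrom_proj v -> cell_type u = cell_type v.
Proof.
move=> /engstrom_proj_eqP; elim=> {u v} [u v|//|u v _ ->//|u v w _ -> _ ->//].
move=> [qp [dxy ab]]; congr (_, _); first by rewrite ab.
rewrite -dxy support_push; last first.
  by have /set_mem[] := valP (projT2 u).2.
rewrite -imset_comp; apply: eq_imset => -[i b] /=.
by congr (_, _); apply: val_inj.
Qed.

Lemma product_cell_type (p : flat M) s e u :
  @product_cell R E M p s e u ->
  cell_type u = (s, widen_copy (leq_subr _ _) @: e)%SET.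
Proof. by move=> [[a x] [/= <- <-] <-]. Qed.

Lemma product_cell_neq0 (p : flat M) s e :
  s \in order_complex_below p -> s != set0 -> e \in D_complex p -> e != set0 ->
  exists u, @product_cell R E M p s e u.
Proof.
move=> sK s0 eK e0; have [a sa] := open_simplex_neq0 sK s0.
have [x ex] := open_simplex_neq0 eK e0.
by exists (existT _ p (a, x)); exists (a, x).
Qed.

(** A cell can be moved down to the summand of the maximum [q] of its chain [s].
    Surjectivity holds because a point of the join at [q] whose support comes
    from the smaller join at [p] is itself the image of a point there. *)
Lemma product_cell_glue (p q : flat M) (qp : (q <= p)%O) s e :
  s \in chains_with_max q -> e \in D_complex p ->
  @engstrom_proj R E M @` product_cell s e =
  @engstrom_proj R E M @` product_cell (p := q) s
     (widen_copy (corank_anti qp) @: e)%SET.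
Proof.
move=> sq eK.
have sKq : s \in order_complex_below q by move: sq; rewrite inE => /andP[].
have sKp : s \in order_complex_below p.
  move: sKq; rewrite !inE => /andP[/subsetP sub ->]; rewrite andbT.
  by apply/subsetP => t /sub; rewrite !inE => /le_trans; apply.
apply/seteqP; split=> _ [_ [[a x] [/= sa ex] <-] <-].
  have aq : realization R (order_complex_below q) (set_val a).
    have /set_mem[a0 a1 _] := valP a; split=> //.
    by rewrite -/(support_of _) sa.
  exists (existT _ q (SigSub (mem_set aq), engstrom_d qp x)).
    exists (SigSub (mem_set aq), engstrom_d qp x) => //; split=> //=.
    rewrite /open_simplex /= support_push ?ex//.
    by have /set_mem[] := valP x.
  apply/engstrom_proj_eqP/rst_sym/rst_step.
  by exists qp; split.
have ap : realization R (order_complex_below p) (set_val a).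
  have /set_mem[a0 a1 _] := valP a; split=> //.
  by rewrite -/(support_of _) sa.
pose w := @widen_copy bool _ _ (corank_anti qp).
have w_inj : injective w by exact: widen_copy_inj.
pose y z : R := set_val x (w z).
have /set_mem[x0 x1 _] := valP x.
have pushy : push w y = set_val x.
  apply/funext => z; rewrite /push.
  have [/existsP[z' /eqP <-]|/existsPn zw] := boolP [exists z', w z' == z].
    by rewrite (big_pred1 z')// => z''; rewrite (inj_eq w_inj).
  rewrite big_pred0 => [|z']; last exact/negbTE.
  apply/esym/eqP; apply: contraT => xz.
  have : z \in support_of (set_val x) by rewrite inE.
  by rewrite ex => /imsetP[z' _ zz']; have := zw z'; rewrite zz' eqxx.
have yp : realization R (D_complex p) y.
  split=> [z||]; first exact: x0.
    rewrite -x1 [LHS](partition_big w predT)//=; apply: eq_bigr => z _.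
    exact: (congr1 (@^~ z) pushy).
  suff -> : support_of y = e by [].
  by apply/setP => z; rewrite inE -(mem_imset _ _ w_inj) -ex inE.
exists (existT _ p (SigSub (mem_set ap), SigSub (mem_set yp))).
  exists (SigSub (mem_set ap), SigSub (mem_set yp)) => //; split=> //=.
  rewrite /open_simplex /=.
  by apply/setP => z; rewrite inE -(mem_imset _ _ w_inj) -ex inE.
apply/engstrom_proj_eqP/rst_step; exists qp; split=> //.
exact: val_inj.
Qed.

Definition cell_index : finType :=
  {p : flat M & ({set flat M} * {set 'I_(corank p) * bool})%type}.

(** The canonical representatives: [e] lives at the maximum of the chain. *)
Definition is_cell_index (t : cell_index) : bool :=
  ((tagged t).1 \in chains_with_max (tag t)) &&
  ((tagged t).2 \in (D_complex (tag t) :\ set0)%SET).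

Definition cell_of (t : cell_index) : set (engstrom_space R M) :=
  @engstrom_proj R E M @` product_cell (tagged t).1 (tagged t).2.

Lemma cell_of_inj : {in is_cell_index &, injective cell_of}.
Proof.
move=> [p [s e]] [p' [s' e']] /andP[/= sp /setD1P[e0 eK]].
move=> /andP[/= sp' /setD1P[e'0 e'K]] tt'.
have /andP[sK ps] : (s \in order_complex_below p) && (p \in s).
  by rewrite inE in sp.
have [|u uc] := product_cell_neq0 sK _ eK e0.
  by apply/set0Pn; exists p.
have : cell_of (existT _ p (s, e)) (engstrom_proj u) by exists u.
rewrite tt' => -[u' u'c /cell_type_proj].
rewrite (product_cell_type uc) (product_cell_type u'c) => -[ss'].
have pp' : p = p' by apply: (chains_with_max_uniq sp); rewrite -ss'.
rewrite ss' {ss' u' u'c tt' sp'}.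
case: _ / pp' in e' e'0 e'K *.
by move=> /(imset_inj (@widen_copy_inj _ _ _ _)) ->.
Qed.

Lemma engstrom_cellsE :
  @engstrom_cells R E M = cell_of @` [set t | is_cell_index t].
Proof.
apply/seteqP; split=> C.
  move=> [p [s [e [sK s0 eK e0 ->]]]].
  have [q sq] : exists q, s \in chains_with_max q.
    apply: chain_has_max => // x y xs ys; move: sK; rewrite inE => /andP[_].
    by move=> /forall_inP/(_ x xs)/forall_inP; apply.
  have qp : (q <= p)%O.
    have /chains_with_maxP[qs _ _] := sq; move: sK; rewrite inE => /andP[+ _].
    by move=> /subsetP/(_ q qs); rewrite inE.
  exists (existT _ q (s, widen_copy (corank_anti qp) @: e)%SET).
    apply/andP; split=> //=; apply/setD1P.
    split; last exact: widen_copy_simplicial.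
    by rewrite -card_gt0 card_imset ?card_gt0//; exact: widen_copy_inj.
  by rewrite /cell_of /= -product_cell_glue.
move=> [[p [s e]] /andP[/= sp /setD1P[e0 eK]] <-].
have /chains_with_maxP[ps _ _] := sp.
exists p, s, e; split=> //; first by move: sp; rewrite inE => /andP[].
by apply/set0Pn; exists p.
Qed.

Lemma f_total_engstrom : f_total (engstrom_S0 R M) =
  1 + \sum_(p : flat M) #|chains_with_max p| * (3 ^ corank p - 1).
Proof.
rewrite /f_total /= engstrom_cellsE; congr (_ + _).
pose I := [set t | is_cell_index t]%SET.
transitivity #|I|.
  rewrite (_ : fset_set _ = [fset cell_of t | t in I]%fset).
    rewrite card_in_imfset//= => [|t t']; first by rewrite -cardE.
    by rewrite !inE; exact: cell_of_inj.
  apply/fsetP => C; rewrite in_fset_set; last first.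
    by apply: finite_image; exact: finite_finset.
  apply/idP/imfsetP => /=.
    by move=> /set_mem[t tc <-]; exists t; rewrite ?inE.
  by move=> [t]; rewrite inE => tc ->; apply/mem_set; exists t.
rewrite -sum1_card (eq_bigl is_cell_index); last by move=> t; rewrite inE.
rewrite -(@sig_big_dep _ _ _ (flat M)
  (fun p => ({set flat M} * {set 'I_(corank p) * bool})%type : finType) predT
  (fun p z => (z.1 \in chains_with_max p) &&
     (z.2 \in (D_complex p :\ set0)%SET)) (fun _ _ => 1))/=.
apply: eq_bigr => p _.
rewrite -(pair_big (mem (chains_with_max p))
  (mem (D_complex p :\ set0)%SET) (fun _ _ => 1)).
by rewrite /= !sum_nat_const muln1 card_join_S0 card_ord.
Qed.

End Cells.

(** * The face numbers *)

Theorem corollary3p4 (R : realType) (E : finType) (M : matroid E) (r n : nat)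
    (hr : matroid_rank M = r) (hn : #|E| = n) :
  f_total (engstrom_S0 R M) <= f_total (engstrom_S0 R (uniform_matroid r n)) /\
  f_total (engstrom_S0 R (uniform_matroid r n)) =
    1 + \sum_(0 <= i < r.+1)
          'C(n, i) * (2 * fubini i - 0 ^ i) * (3 ^ (r - i) - 1).
Proof.
have rn : r <= n.
  rewrite -hr -hn -cardsT; apply/bigmax_leqP => I _.
  exact/subset_leq_card/subsetT.
have uniformE : f_total (engstrom_S0 R (uniform_matroid r n)) =
    1 + \sum_(0 <= i < r.+1)
          'C(n, i) * (2 * fubini i - 0 ^ i) * (3 ^ (r - i) - 1).
  rewrite f_total_engstrom /corank matroid_rank_uniform//.
  rewrite (sum_chains_uniform n (g := fun i => 3 ^ (r - i) - 1)) ?subnn//.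
  rewrite (sum_small_sets _ _ (fun i => boolean_chains i * (3 ^ (r - i) - 1))).
  by rewrite card_ord; congr (_ + _); apply: eq_bigr => i _; rewrite mulnA.
split=> //; rewrite uniformE f_total_engstrom leq_add2l /corank hr.
apply: leq_trans (sum_chains_flat_le M (fun i => 3 ^ (r - i) - 1)) _.
rewrite hr (sum_small_sets _ _ (fun i => boolean_chains i * (3 ^ (r - i) - 1))).
by rewrite hn; apply/eq_leq/eq_bigr => i _; rewrite mulnA.
Qed.
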